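(* Let $k$ be a positive integer and let $G$ be a $k$-degenerate graph on $n$ vertices. Then $\dim_{\mathrm{TH}}(G) \leq 10k\ln n$.
   Context: A graph is $k$-degenerate if its vertices admit an ordering in which every vertex has at most $k$ neighbors appearing after it. A graph $G$ on $n$ vertices is a threshold graph if there exist real numbers $a_1,\dots,a_n,b$ such that the $0$-$1$ solutions of $\sum_{i=1}^n a_ix_i\le b$ are exactly the characteristic vectors of the cliques of $G$ (equivalently, $G$ has no induced $2K_2$, $P_4$ or $C_4$). For graphs $G_1,\dots,G_k$ on the same vertex set $V$, $G=G_1\cap\cdots\cap G_k$ means $V(G)=V$ and $E(G)=\bigcap_i E(G_i)$. The threshold dimension $\dim_{\mathrm{TH}}(G)$ is the smallest number of threshold graphs on $V(G)$ whose intersection is $G$. Graphs are finite, simple and undirected. *)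

(* Defs.v *)
From HB Require Import structures.
From mathcomp Require Import all_boot all_order all_algebra.
From mathcomp Require Import boolp reals exp.

Set Implicit Arguments.
Unset Strict Implicit.
Unset Printing Implicit Defensive.

Import Order.TTheory GRing.Theory Num.Theory.
Local Open Scope ring_scope.

Record sgraph (T : finType) := SGraph {
  adj : rel T;
  adj_sym : symmetric adj;
  adj_irrefl : irreflexive adj }.

Definition degenerate (T : finType) (k : nat) (G : sgraph T) : Prop :=
  exists s : seq T,
    [/\ uniq s, (forall v, v \in s) &
        forall v, (#|[set w | adj G v w & (index v s < index w s)%N]| <= k)%N].

Definition is_clique (T : finType) (G : sgraph T) (A : {set T}) : Prop :=
  {in A &, forall u v, u != v -> adj G u v}.

(* The 0-1 vectors indexed by T are exactly the characteristic vectors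
   i |-> (i \in A)%:R of the sets A : {set T}. *)
Definition threshold_graph (R : realType) (T : finType) (G : sgraph T) : Prop :=
  exists (a : T -> R) (b : R), forall A : {set T},
    \sum_i a i * (i \in A)%:R <= b <-> is_clique G A.

(* Only pairs of distinct vertices are compared, so that the intersection of
   the empty family (m = 0) is the complete graph on T. *)
Definition is_intersection (T : finType) (G : sgraph T)
    (m : nat) (H : 'I_m -> sgraph T) : Prop :=
  forall u v, u != v -> (adj G u v <-> forall i, adj (H i) u v).

Definition threshold_cover (R : realType) (T : finType) (G : sgraph T)
    (m : nat) : Prop :=
  exists H : 'I_m -> sgraph T,
    (forall i, threshold_graph R (H i)) /\ is_intersection G H.

Section CompleteMinusEdge.
Variables (T : finType) (p q : T).

Definition cme_rel : rel T :=
  fun u v => (u != v) && ([set u; v] != [set p; q]).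

Lemma cme_sym : symmetric cme_rel.
Proof. by move=> u v; rewrite /cme_rel eq_sym setUC. Qed.

Lemma cme_irrefl : irreflexive cme_rel.
Proof. by move=> u; rewrite /cme_rel eqxx. Qed.

Definition complete_minus_edge : sgraph T := SGraph cme_sym cme_irrefl.

Lemma complete_minus_edge_threshold (R : realType) :
  p != q -> threshold_graph R complete_minus_edge.
Proof.
move=> pq; exists (fun i => (i == p)%:R + (i == q)%:R), 1 => A.
have sumE (r : T) : \sum_i (i == r)%:R * (i \in A)%:R = (r \in A)%:R :> R.
  rewrite (bigD1 r) //= eqxx mul1r big1 ?addr0 // => i /negbTE ->.
  by rewrite mul0r.
under eq_bigr do rewrite mulrDl.
rewrite big_split /= !sumE -natrD lern1; split=> [le1 u v uA vA uv|cA].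
  rewrite /= /cme_rel uv /=; apply/negP => /eqP /setP eqS.
  have pqA r : r \in [set p; q] -> r \in A.
    by rewrite -eqS => /set2P [] ->.
  by move: le1; rewrite !pqA // ?set21 ?set22.
case pA: (p \in A); case qA: (q \in A) => //.
by have := cA p q pA qA pq; rewrite /= /cme_rel pq eqxx.
Qed.

End CompleteMinusEdge.

(* Every graph is an intersection of threshold graphs: remove its non-edges from
   the complete graph one at a time. *)
Lemma threshold_cover_exists (R : realType) (T : finType) (G : sgraph T) :
  exists m, `[< threshold_cover R G m >].
Proof.
pose P := [set x : T * T | (x.1 != x.2) && ~~ adj G x.1 x.2].
exists #|P|; apply/asboolP.
exists (fun i => complete_minus_edge (enum_val i).1 (enum_val i).2).
split=> [i|u v uv].
  apply: complete_minus_edge_threshold.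
  by have := enum_valP i; rewrite inE => /andP [].
split=> [Guv i|Huv].
  have := enum_valP i; case: (enum_val i) => p q; rewrite inE /= => /andP [pq].
  apply: contraNT; rewrite /cme_rel uv /= negbK => /eqP /setP eqS.
  have := eqS u; have := eqS v; rewrite !inE !eqxx orbT /=.
  move=> /esym /orP [] /eqP ev /esym /orP [] /eqP eu; subst.
  - by rewrite eqxx in uv.
  - by rewrite adj_sym.
  - by [].
  - by rewrite eqxx in uv.
apply: contraT => nG.
have uvP : (u, v) \in P by rewrite inE /= uv.
have := Huv (enum_rank_in uvP (u, v)).
by rewrite enum_rankK_in //= /cme_rel eqxx andbF.
Qed.

Definition threshold_dim (R : realType) (T : finType) (G : sgraph T) : nat :=
  ex_minn (threshold_cover_exists R G).

(* Main.v *)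
Require Import Defs.
From HB Require Import structures.
From mathcomp Require Import all_boot all_order all_algebra.
From mathcomp Require Import boolp reals exp.
From mathcomp Require Import sequences zify ring lra.

Set Implicit Arguments.
Unset Strict Implicit.
Unset Printing Implicit Defensive.

Import Order.TTheory GRing.Theory Num.Theory.
Local Open Scope ring_scope.

(** Order the vertices so that each has at most [k] neighbours after it, and take
    a proper coloring [c] with [5 k] colors.  For a color class [I], complete the
    complement of [I] to a clique and join [y] in [I] to [x] outside [I] when [x]
    has a neighbour in [I] at or after [y]: this is a threshold supergraph of [G].
    It misses a non-edge [x < y] as soon as the color of [y] does not occur among
    the later neighbours of [x].  Coloring greedily from the last vertex leaves at
    least [4 k] choices at each step, so by averaging a coloring can be chosen
    that fails on at most a quarter of any given set of non-edges.  Hence [r]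
    colorings, i.e. [5 k r] threshold graphs, suffice once [4 ^ r] exceeds the
    number of non-edges, and [r <= 2 ln n] can be achieved. *)

(** * Threshold weights for split graphs with nested neighbourhoods *)

Section SplitGraph.
Variables (T : finType) (I : pred T) (p : T -> nat).

(* Two vertices of [I] are never adjacent, as both strict inequalities would be
   required. *)
Definition split_rel : rel T := fun u v =>
  [&& u != v, I u ==> (p u < p v)%N & I v ==> (p v < p u)%N].

Lemma split_rel_sym : symmetric split_rel.
Proof. by move=> u v; rewrite /split_rel eq_sym; congr andb; rewrite andbC. Qed.

Lemma split_rel_irrefl : irreflexive split_rel.
Proof. by move=> u; rewrite /split_rel eqxx. Qed.

Definition split_graph : sgraph T := SGraph split_rel_sym split_rel_irrefl.

Local Open Scope nat_scope.

(* A vertex outside [I] of level [l] weighs [B ^ (N - l)], and a vertex of [I] of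
   level [l] leaves room [B ^ (N - l) - 1]: this excludes any outside vertex of
   level at most [l], but accommodates all those of larger level together. *)
Let B := #|T|.+1.
Let N := (\max_v p v).+1.
Let b := 2 * B ^ N.+1.
Let weight v := if I v then b.+1 - B ^ (N - p v) else B ^ (N - p v).

Let p_lt v : p v < N. Proof. by rewrite ltnS leq_bigmax. Qed.

Let expB_bound v : 0 < B ^ (N - p v) <= B ^ N.
Proof. by rewrite expn_gt0 /= leq_pexp2l // leq_subr. Qed.

(** Since [2 * B ^ N <= b], two vertices of [I] are too heavy together; since [#|T| * B ^ N <= b],
    any set outside [I] fits. *)
Let b_bound : B ^ N.+1 + B ^ N <= b.
Proof. by rewrite /b mul2n -addnn leq_add2l leq_pexp2l. Qed.

Let weight_nonadjacent u v : I u -> p v <= p u -> b < weight u + weight v.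
Proof.
move=> Iu puv; rewrite /weight Iu; case: ifP => Iv.
  have := expB_bound u; have := expB_bound v; have := b_bound.
  have : B ^ N <= B ^ N.+1 by rewrite leq_pexp2l.
  lia.
have : B ^ (N - p u) <= B ^ (N - p v) by rewrite leq_pexp2l // leq_sub2l.
lia.
Qed.

Let sum_weight_clique (A : {set T}) :
  is_clique split_graph A -> \sum_(v in A) weight v <= b.
Proof.
move=> clA; case: (pickP [pred s in A | I s]) => [s /andP [sA Is] | noI].
  (* A clique has only one vertex [s] in [I]; the others lie outside at larger levels, and at most
     [B - 1] of them weigh less than [B ^ (N - p s)] together. *)
  have weight_rest v : v \in A -> v != s -> weight v <= B ^ (N - p s).-1.
    move=> vA vs; have /and3P [_] := clA v s vA sA vs.
    rewrite Is /weight /=; case: ifP => /= _ ; first by lia.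
    move=> _ psv; rewrite leq_pexp2l //; lia.
  rewrite (bigD1 s) //=.
  have : \sum_(v in A | v != s) weight v <= #|T| * B ^ (N - p s).-1.
    apply: (@leq_trans (\sum_(v in A | v != s) B ^ (N - p s).-1)).
      by apply: leq_sum => v /andP [vA vs]; exact: weight_rest.
    by rewrite sum_nat_const leq_mul2r max_card orbT.
  have -> : weight s = b.+1 - B ^ (N - p s) by rewrite /weight Is.
  have : B ^ (N - p s) = #|T| * B ^ (N - p s).-1 + B ^ (N - p s).-1.
    have -> : N - p s = (N - p s).-1.+1 by have := p_lt s; lia.
    by rewrite /= expnS {1}/B mulSn addnC.
  have : 0 < B ^ (N - p s).-1 by rewrite expn_gt0.
  have := expB_bound s; have := b_bound; lia.
apply: (@leq_trans (\sum_(v in A) B ^ N)).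
  apply: leq_sum => v vA; rewrite /weight.
  have := noI v; rewrite /= vA /= => ->.
  by have /andP [] := expB_bound v.
rewrite sum_nat_const; apply: leq_trans b_bound; rewrite expnS.
by apply: leq_trans (leq_addr _ _); rewrite leq_mul2r ltnW ?orbT // ltnS max_card.
Qed.

Lemma split_graph_threshold (R : realType) : threshold_graph R split_graph.
Proof.
exists (fun v => (weight v)%:R%R), b%:R%R => A.
have -> : (\sum_i (weight i)%:R * (i \in A)%:R = (\sum_(i in A) weight i)%:R :> R)%R.
  rewrite natr_sum [RHS]big_mkcond /=; apply: eq_bigr => i _.
  by case: (i \in A); rewrite ?mulr1 ?mulr0.
rewrite ler_nat; split; last exact: sum_weight_clique.
move=> leb u v uA vA uv.
have lt_pair x y : x \in A -> y \in A -> x != y -> I x ==> (p x < p y).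
  move=> xA yA xy; apply/implyP => Ix; rewrite ltnNge; apply/negP => pyx.
  have := weight_nonadjacent Ix pyx; apply/negP; rewrite -leqNgt.
  apply: leq_trans leb; rewrite (bigD1 x) //= leq_add2l (bigD1 y) /=.
    exact: leq_addr.
  by rewrite yA eq_sym.
by rewrite /= /split_rel uv !lt_pair // eq_sym.
Qed.

End SplitGraph.

(** * Greedy coloring by averaging *)

Section Counting.
Local Open Scope nat_scope.

Lemma leq_card_mul_min (C : finType) (S : {set C}) (cost : C -> nat) d m :
  0 < d <= #|S| -> \sum_(a in S) cost a <= m -> exists2 a, a \in S & d * cost a <= m.
Proof.
case/andP=> d_gt0 dS le_m.
have [a0 a0S] : exists a, a \in S by apply/card_gt0P; exact: leq_trans dS.
case: (arg_minnP cost a0S) => a aS amin; exists a => //.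
apply: leq_trans le_m; apply: (@leq_trans (#|S| * cost a)).
  by rewrite leq_mul2r dS orbT.
by rewrite -sum_nat_const; apply: leq_sum => x; exact: amin.
Qed.

(* Colour the vertices by decreasing rank; among the at least [d] colours
   allowed at a vertex, one of least cost is responsible for at most a fraction
   [1 / d] of the pairs whose lower end is that vertex. *)
Lemma greedy_coloring (T J C : finType) (e : rel T) (rk : T -> nat) (k d : nat)
    (f g : J -> T) (D : {set J}) :
  injective rk -> 0 < d -> k + d <= #|C| ->
  (forall v, #|[set w | e v w & rk v < rk w]| <= k) ->
  {in D, forall j, rk (f j) < rk (g j)} ->
  exists c : T -> C, (forall u v, rk u < rk v -> e u v -> c u != c v) /\
    d * #|[set j in D | c (f j) == c (g j)]| <= #|D|.
Proof.
move=> rk_inj d_gt0 kdC deg_le fg.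
pose above m := [set j in D | m <= rk (f j)].
(* Induction on the number [i] of top ranks already treated; pairs are counted once their lower end
   is reached. *)
suff H i : exists c : T -> C,
    (forall u v, (\max_v rk v).+1 - i <= rk u -> rk u < rk v -> e u v -> c u != c v) /\
    d * #|[set j in above ((\max_v rk v).+1 - i) | c (f j) == c (g j)]|
      <= #|above ((\max_v rk v).+1 - i)|.
  have [c []] := H (\max_v rk v).+1; rewrite subnn => c1 c2.
  exists c; split=> [u v|]; first exact: c1.
  have E : above 0 = D by apply/setP => j; rewrite inE leq0n andbT.
  by rewrite E in c2.
elim: i => [|i [c [c_proper c_cost]]].
  have [c0 _] : exists c0 : C, c0 \in C.
    by apply/card_gt0P; apply: leq_trans kdC; rewrite addn_gt0 d_gt0 orbT.
  exists (fun=> c0); rewrite subn0; split=> [u v|].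
    by rewrite ltnNge leq_bigmax.
  rewrite (_ : [set j in above _ | _] = set0) ?cards0 ?muln0 //.
  by apply/setP => j; rewrite !inE ltnNge leq_bigmax andbF.
set M := \max_v rk v in c_proper c_cost *.
have [iM|Mi] := leqP M.+1 i.
  have E : M.+1 - i.+1 = M.+1 - i by lia.
  by rewrite E; exists c.
have [m [E1 E2]] : exists m, M.+1 - i.+1 = m /\ M.+1 - i = m.+1.
  by exists (M - i); split; lia.
rewrite {}E2 in c_proper c_cost; rewrite {}E1.
case: (pickP [pred v | rk v == m]) => [v /eqP rkv|no_v]; last first.
  have no_m u : m <= rk u -> m < rk u.
    by rewrite leq_eqVlt eq_sym; have /= -> := no_v u.
  have E : above m = above m.+1.
    apply/setP => j; rewrite !inE; case: (j \in D) => //=.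
    by apply/idP/idP => [/no_m //|/ltnW].
  by rewrite E; exists c; split=> // u w /no_m; exact: c_proper.
pose allowed := ~: (c @: [set w | e v w & rk v < rk w]).
pose new := [set j in D | f j == v].
have d_allowed : 0 < d <= #|allowed|.
  rewrite d_gt0 /= cardsCs setCK.
  have := leq_imset_card c [set w | e v w & rk v < rk w].
  by have := deg_le v; move: kdC; lia.
have [|a a_allowed a_cost] := @leq_card_mul_min _ allowed
    (fun a => #|[set j in new | c (g j) == a]|) d #|new| d_allowed.
  (* Over all colors, each new pair is charged exactly once, to the color of its upper end. *)
  apply: (@leq_trans (\sum_a #|[set j in new | c (g j) == a]|)).
    by rewrite [leqRHS](bigID (mem allowed)) /= leq_addr.
  rewrite -[leqRHS]sum1_card (partition_big (c \o g) xpredT) //=.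
  apply: leq_sum => a _; rewrite -sum1_card.
  by apply: eq_leq; apply: eq_bigl => j; rewrite !inE.
pose c' u := if u == v then a else c u.
have rk_neq u : m < rk u -> (u == v) = false.
  by move=> mu; apply/eqP => uv; move: mu; rewrite uv rkv ltnn.
have above_split : above m = new :|: above m.+1.
  apply/setP => j; rewrite !inE -andb_orr; congr andb.
  by rewrite leq_eqVlt -rkv (inj_eq rk_inj) eq_sym.
have new_above : [disjoint new & above m.+1].
  apply/pred0P => j /=; rewrite !inE; apply/negP => /andP [] /andP [_ /eqP ->].
  by rewrite rkv ltnn andbF.
exists c'; split=> [u w|].
  rewrite leq_eqVlt => /orP [/eqP mu uw euw|mu uw euw].
    have uv : u = v by apply: rk_inj; rewrite rkv.
    subst u; rewrite /c' eqxx rk_neq ?mu //.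
    apply: contraTneq a_allowed => ->; rewrite inE negbK imset_f // inE euw //.
  by rewrite /c' !rk_neq // ?c_proper // (ltn_trans mu).
(* Monochromatic pairs are either new, paid for by [a], or old, with both ends above rank [m] and
   hence not recolored. *)
rewrite above_split cardsU disjoint_setI0 // cards0 subn0.
apply: leq_trans (leq_add a_cost c_cost); rewrite -mulnDr leq_mul2l.
apply/orP; right; rewrite -[leqRHS]subn0.
rewrite -[X in _ - X](_ : #|[set j in new | c (g j) == a] :&:
    [set j in above m.+1 | c (f j) == c (g j)]| = 0).
  rewrite -cardsU; apply: subset_leq_card; apply/subsetP => j.
  rewrite !inE; case jD: (j \in D) => //=; have := fg j jD.
  have [-> | fjv] := eqVneq (f j) v; rewrite /= => fgj.
    by rewrite /c' eqxx rk_neq -?rkv //= eq_sym => ->.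
  move=> /andP [fjm]; rewrite /c' (negbTE fjv) (rk_neq _ (ltn_trans fjm fgj)) => ->.
  by rewrite fjm.
apply/eqP; rewrite cards_eq0 -subset0; apply/subsetP => j; rewrite !inE.
move=> /andP [] /andP [] /andP [_ /eqP ->] _; by rewrite rkv ltnn andbF.
Qed.

End Counting.

(** * Bounding the number of colorings *)

(** From [1 + x <= expR x] at [x = - 1 / 6], [expR 1 <= (6 / 5) ^ 6 < 3]. *)
Lemma expR1_le3 (R : realType) : expR 1 <= 3 :> R.
Proof.
have h : 5 / 6 <= expR (- (1 / 6)) :> R by have := expR_ge1Dx (- (1 / 6) : R); lra.
have : (5 / 6) ^+ 6 <= expR (- (1 / 6)) ^+ 6 :> R by rewrite lerXn2r // nnegrE ?expR_ge0; lra.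
rewrite -expRM_natl (_ : 6%:R * - (1 / 6) = - 1 :> R); last by field.
rewrite expRN => h6.
have e0 := expR_gt0 (1 : R).
have : (5 / 6) ^+ 6 * expR 1 <= 1 :> R by rewrite -ler_pdivlMr // div1r.
lra.
Qed.

Lemma natr_le_2ln (R : realType) r n : (0 < n)%N -> (3 ^ r <= n ^ 2)%N ->
  r%:R <= 2 * ln (n%:R : R).
Proof.
move=> n0 le_rn.
have n0R : 0 < n%:R :> R by rewrite ltr0n.
rewrite mulr_natl -lnXn // -ler_expR lnK ?posrE ?exprn_gt0 //.
rewrite -[r%:R]mulr1 expRM_natl.
apply: (@le_trans _ _ (3 ^+ r)); first by rewrite lerXn2r ?nnegrE ?expR_ge0 ?expR1_le3.
by rewrite -!natrX ler_nat.
Qed.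

(** For the least [r], [2 * 4 ^ (r - 1) <= 2 * f <= n ^ 2], which dominates [3 ^ r] once [r >= 3];
    [r = 1, 2] use integrality of [n]. *)
Lemma exists_pow4_gt f n : (2 * f + n <= n ^ 2)%N ->
  exists r, (f < 4 ^ r)%N /\ (r = 0%N \/ (0 < n)%N /\ (3 ^ r <= n ^ 2)%N).
Proof.
move=> fn.
have ex : exists r, (f < 4 ^ r)%N by exists f; exact: ltn_expl.
case: (ex_minnP ex) => r fr rmin; exists r; split=> //.
case: r fr rmin => [|r] fr rmin; [by left | right].
have le_f : (4 ^ r <= f)%N by rewrite leqNgt; apply/negP => /rmin; rewrite ltnn.
have pos : (0 < 4 ^ r)%N by rewrite expn_gt0.
split; first by nia.
case: r fr rmin le_f pos => [|[|r]] _ _ le_f pos.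
- by rewrite expn1; nia.
- have : (4 <= n)%N by rewrite expn1 in le_f; nia.
  by nia.
have : (3 ^ r <= 4 ^ r)%N by case: (r) => // m; rewrite leq_exp2r.
by rewrite !expnS in le_f *; lia.
Qed.

(** * Separating colorings and graphs of color classes *)

Section SeparatingColorings.
Variables (T : finType) (G : sgraph T) (rk : T -> nat) (k : nat).
Hypotheses (rk_inj : injective rk) (k_gt0 : (0 < k)%N).
Hypothesis deg_le : forall v, (#|[set w | adj G v w & (rk v < rk w)%N]| <= k)%N.

Definition proper_coloring (C : finType) (c : T -> C) :=
  forall u v, adj G u v -> c u != c v.

Definition separates (C : finType) (c : T -> C) (u v : T) :=
  [forall z, adj G u z && (rk u < rk z)%N ==> (c z != c v)].

Local Open Scope nat_scope.

(** A non-edge [(x, y)] fails only if [y] shares its color with one of the at most [k] later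
    neighbours of [x]. Of these at most [k * #|F|] pairs, the greedy coloring makes at most a
    fraction [1 / (d * k)] monochromatic. *)
Lemma proper_coloring_separating (C : finType) d (F : {set T * T}) :
  0 < d -> k + d * k <= #|C| -> {in F, forall x, ~~ adj G x.1 x.2} ->
  exists2 c : T -> C, proper_coloring c &
    d * #|[set x in F | ~~ separates c x.1 x.2]| <= #|F|.
Proof.
move=> d_gt0 kC nadjF.
pose D := [set t : T * T * T |
  (t.1 \in F) && (adj G t.1.1 t.2 && (rk t.1.1 < rk t.2))].
pose lo (t : T * T * T) := if rk t.2 < rk t.1.2 then t.2 else t.1.2.
pose hi (t : T * T * T) := if rk t.2 < rk t.1.2 then t.1.2 else t.2.
have lohi : {in D, forall t, rk (lo t) < rk (hi t)}.
  case=> [[x y] z]; rewrite inE /= => /andP [/nadjF /= nxy] /andP [xz _].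
  (* Here [y] and [z] differ because only [z] is adjacent to [x]. *)
  rewrite /lo /hi /=; case: (ltngtP (rk z) (rk y)) => // /rk_inj zy.
  by rewrite -zy xz in nxy.
have [|c [c_fwd c_cost]] :=
  greedy_coloring rk_inj _ kC deg_le lohi; first by rewrite muln_gt0 d_gt0.
exists c => [u v uv|].
  case: (ltngtP (rk u) (rk v)) => [lt_uv|lt_vu|/rk_inj uv'].
  - exact: c_fwd.
  - by rewrite eq_sym c_fwd // adj_sym.
  - by rewrite uv' adj_irrefl in uv.
have cardD : #|D| <= #|F| * k.
  rewrite -sum1_card (partition_big fst (mem F)) /=; last first.
    by move=> t; rewrite inE => /andP [].
  rewrite -sum_nat_const; apply: leq_sum => x xF.
  apply: leq_trans (deg_le x.1); rewrite sum1_card.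
  rewrite -(card_imset [set w | adj G x.1 w & rk x.1 < rk w] (f := pair x)); last first.
    by move=> ? ? [].
  apply: subset_leq_card; apply/subsetP => -[x' z].
  rewrite unfold_in /= inE /= => /andP [/andP [_ xz]] /eqP <-.
  by apply: imset_f; rewrite inE.
have : #|[set x in F | ~~ separates c x.1 x.2]| <= #|[set t in D | c (lo t) == c (hi t)]|.
  apply: leq_trans (leq_imset_card fst _); apply: subset_leq_card.
  apply/subsetP => x; rewrite inE => /andP [xF] /forallPn [z].
  rewrite negb_imply negbK => /andP [xz /eqP czy].
  apply/imsetP; exists (x, z) => //; rewrite !inE /= xF xz /=.
  by rewrite /lo /hi /=; case: ifP; rewrite czy.
rewrite -(leq_pmul2r k_gt0) => le_bad; move: (leq_trans c_cost cardD).
have := leq_mul (leqnn d) le_bad; move: k_gt0; nia.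
Qed.

(** Each new coloring leaves at most a fraction [1 / d] of the pairs, so after [r] of them fewer
    than one remains. *)
Lemma separating_family (C : finType) d r (F : {set T * T}) :
  0 < d -> k + d * k <= #|C| -> {in F, forall x, ~~ adj G x.1 x.2} ->
  #|F| < d ^ r ->
  exists c : 'I_r -> T -> C, (forall i, proper_coloring (c i)) /\
    {in F, forall x, exists i, separates (c i) x.1 x.2}.
Proof.
move=> d_gt0 kC; elim: r F => [|r IH] F nadjF ltF.
  exists (fun i : 'I_0 => match notF (ltn_ord i) with end); split=> [[]//|x xF].
  by move: ltF; rewrite ltnS leqn0 cards_eq0 => /eqP F0; rewrite F0 inE in xF.
have [c c_proper c_bad] := proper_coloring_separating d_gt0 kC nadjF.
have [||cs [cs_proper cs_sep]] := IH [set x in F | ~~ separates c x.1 x.2].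
- by move=> x; rewrite inE => /andP [/nadjF].
- by rewrite -(ltn_pmul2l d_gt0) -expnS (leq_ltn_trans c_bad).
exists (fun i => oapp cs c (unlift ord0 i)); split=> [i|x xF].
  by case: unliftP => [j _|_] //=; exact: cs_proper.
case sep: (separates c x.1 x.2); first by exists ord0; rewrite unlift_none.
have [|i sep_i] := cs_sep x; first by rewrite inE xF sep.
by exists (lift ord0 i); rewrite liftK.
Qed.

Section ColorClass.
Variables (C : finType) (c : T -> C) (a : C).

(** The successor turns [at or after] into the strict inequality of [split_rel]; the empty maximum
    [0] joins a vertex without neighbours in the class to none of it. *)
Definition color_level v :=
  if c v == a then rk v else \max_(w | (c w == a) && adj G v w) (rk w).+1.

Definition color_graph := split_graph (fun v => c v == a) color_level.

Lemma color_graph_super u v :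
  proper_coloring c -> adj G u v -> adj color_graph u v.
Proof.
move=> c_proper.
have lt_level x y : adj G x y -> (c x == a) ==> (color_level x < color_level y).
  move=> xy; apply/implyP => /eqP cx; have := c_proper x y xy.
  rewrite /color_level cx eqxx eq_sym => /negbTE ->.
  by rewrite (bigD1 x) /= ?leq_max ?leqnn // cx eqxx adj_sym.
move=> uv; apply/and3P; split; first by apply: contraTneq uv => ->; rewrite adj_irrefl.
  exact: lt_level.
by apply: lt_level; rewrite adj_sym.
Qed.

End ColorClass.

(** If [u] is outside the class of [v], adjacency would need a neighbour [w] of [u] in that class at
    or after [v]; [w = v] contradicts the non-edge, and a later [w] contradicts separation. *)
Lemma color_graph_separates (C : finType) (c : T -> C) u v :
  rk u < rk v -> ~~ adj G u v -> separates c u v -> ~~ adj (color_graph c (c v)) u v.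
Proof.
move=> uv nuv /forallP sep; rewrite /= /split_rel eqxx /=; apply/negP.
case/and3P=> _ _; apply/negP; rewrite -leqNgt /color_level eqxx.
case: ifP => [_|_]; first exact: ltnW.
apply/bigop.bigmax_leqP => w /andP [cw uw]; rewrite ltnNge leq_eqVlt.
apply/negP => /orP [/eqP /rk_inj vw|vw]; first by rewrite vw uw in nuv.
by have := sep w; rewrite uw (ltn_trans uv vw) cw.
Qed.

End SeparatingColorings.

(** * Assembling the bound *)

Lemma threshold_dim_le (R : realType) (T J : finType) (G : sgraph T)
    (H : J -> sgraph T) :
  (forall j, threshold_graph R (H j)) ->
  (forall u v, u != v -> (adj G u v <-> forall j, adj (H j) u v)) ->
  (threshold_dim R G <= #|J|)%N.
Proof.
move=> thrH capH; rewrite /threshold_dim; case: ex_minnP => m _; apply.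
apply/asboolP; exists (fun i => H (enum_val i)); split=> [i|u v uv].
  exact: thrH.
rewrite capH //; split=> adjH j; first exact: adjH.
by have := adjH (enum_rank j); rewrite enum_rankK.
Qed.

(** [F], its transpose and the diagonal are disjoint in [T * T]. *)
Lemma double_card_lt_pairs (T : finType) (rk : T -> nat) (F : {set T * T}) :
  {in F, forall x, rk x.1 < rk x.2}%N -> (2 * #|F| + #|T| <= #|T| ^ 2)%N.
Proof.
move=> ltF; pose swap (x : T * T) := (x.2, x.1).
have swapK : cancel swap swap by case.
rewrite -[leqRHS]mulnn -card_prod -[leqRHS](cardsC F) mul2n -addnn -addnA leq_add2l.
rewrite -[X in (X + _)%N](card_imset F (can_inj swapK)).
rewrite -(card_imset T (f := fun x => (x, x))); last by move=> x y [].
rewrite -cardsUI (_ : _ :&: _ = set0) ?cards0 ?addn0; last first.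
  apply/setP => x; rewrite !inE; apply/negP => /andP [] /imsetP [y /ltF yF ->].
  by case/imsetP => z _ [y2 y1]; rewrite y2 y1 ltnn in yF.
apply: subset_leq_card; apply/subsetP => x; rewrite !inE.
case/orP=> /imsetP [y yF ->]; apply/negP => /ltF /=; last by rewrite ltnn.
by rewrite ltnNge ltnW ?ltF.
Qed.

Theorem theorem6 (R : realType) (T : finType) (G : sgraph T) (k n : nat)
  (k_gt0 : (0 < k)%N) (card_T : #|T| = n) (G_deg : degenerate k G) :
  (threshold_dim R G)%:R <= 10 * k%:R * ln (n%:R : R).
Proof.
have [s [_ s_full deg_le]] := G_deg.
pose rk v := index v s.
have rk_inj : injective rk.
  by move=> u v E; rewrite -(nth_index u (s_full u)) -[index u s]/(rk u) E nth_index.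
pose F := [set x : T * T | (rk x.1 < rk x.2)%N && ~~ adj G x.1 x.2].
have nadjF : {in F, forall x, ~~ adj G x.1 x.2} by move=> x; rewrite inE => /andP [].
have [|r [ltF r_small]] := @exists_pow4_gt #|F| n.
  by rewrite -card_T; apply: (@double_card_lt_pairs _ rk) => x; rewrite inE => /andP [].
(* With [d = 4], [k + d * k = 5 * k] colors suffice. *)
have [|c [c_proper c_sep]] :=
  separating_family rk_inj k_gt0 deg_le (C := 'I_(5 * k)) (isT : 0 < 4)%N _ nadjF ltF.
  by rewrite card_ord mulSn.
have dim_le : (threshold_dim R G <= r * (5 * k))%N.
  have := @threshold_dim_le R _ _ G
    (fun j : 'I_r * 'I_(5 * k) => color_graph G rk (c j.1) j.2).
  rewrite card_prod !card_ord; apply.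
    by move=> j; exact: split_graph_threshold.
  move=> u v uv; split=> [Guv j|]; first exact: color_graph_super.
  have cover x y : (rk x < rk y)%N ->
      (forall j : 'I_r * 'I_(5 * k), adj (color_graph G rk (c j.1) j.2) x y) -> adj G x y.
    move=> xy Hxy; apply: contraT => nxy.
    have [|i sep] := c_sep (x, y); first by rewrite inE xy.
    by have := color_graph_separates rk_inj xy nxy sep; rewrite (Hxy (i, c i y)).
  case: (ltngtP (rk u) (rk v)) => [lt_uv|lt_vu|/rk_inj E]; first exact: cover.
    by move=> Huv; rewrite adj_sym; apply: cover => // j; rewrite adj_sym.
  by rewrite E eqxx in uv.
apply: (@le_trans _ _ (r * (5 * k))%:R); first by rewrite ler_nat.
case: r_small => [->|[n_gt0 r_small]].
  (* The convention [ln 0 = 0] covers the empty graph. *)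
  rewrite mul0n; case: (posnP n) => [->|n_gt0]; first by rewrite ln0 ?mulr0.
  by rewrite !mulr_ge0 // ln_ge0 // ler1n.
have := natr_le_2ln R n_gt0 r_small.
rewrite -(ler_pM2r (_ : 0 < (5 * k)%:R :> R)) ?ltr0n ?muln_gt0 // !natrM.
by move=> /le_trans -> //; rewrite le_eqVlt; apply/orP; left; apply/eqP; ring.
Qed.
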